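(* Let $r>1$ and $e>1$ be integers and let $s=(s_0=0,s_1,\dots,s_e)$, with $s_e>0$, be a socle-vector with $r\geq\text{min.emb.dim.}(s)$ and $\mathrm{type}(s)=2$. Then there exists a generalized compressed algebra for the pair $(r,s)$. Moreover, when $s_e=1$ and $s_p=1$ for some $1\le p<e$ (all other entries being zero), its $h$-vector $H=(h_0=1,h_1,\dots,h_e)$ is the following. (a) If $p\geq\frac e2$, then $h_i=\min\{N(r,i)-r_i,\,N(r,i)\}$ for $i=0,1,\dots,e$. (b) If $p<\frac e2$, then $h_i=N(r,i)$ for $i=0,\dots,p$; $h_{p+a}=\big((N(r,p)-1)_{(p)}\big)_a^a$ for $a=1,\dots,\lfloor\frac e2\rfloor-p$; $h_i=h_{e-i}$ for $i>\lfloor\frac e2\rfloor$, $i\neq e-p$; and $h_{e-p}=N(r,p)-1$.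
   Context: Fix a field $k$ of characteristic zero. An algebra means a standard graded artinian algebra $A=R/I=\bigoplus_{i=0}^e A_i$, where $R=k[x_1,\dots,x_r]$ with all $x_i$ of degree $1$, $I$ is a homogeneous ideal containing no non-zero forms of degree $1$, and $e$ is the last index with $A_e\neq 0$. The embedding dimension of $A$ is $r$. The $h$-vector of $A$ is $h(A)=(1,h_1,\dots,h_e)$ with $h_i=\dim_k A_i$ (so $h_1=r$). The socle of $A$ is $soc(A)=\{a\in A \mid a\,\overline{m}=0\}$, where $\overline{m}$ is the maximal homogeneous ideal of $A$; it is a homogeneous ideal, and the socle-vector of $A$ is $s(A)=(s_0,\dots,s_e)$ with $s_i=\dim_k soc(A)_i$ (so $s_0=0$ and $s_e=h_e>0$). The type of $s$ is $\mathrm{type}(s)=\sum_{i=1}^e s_i$. For a vector $s=(0,s_1,\dots,s_e)$, an algebra has data $(r,s)$ if it has embedding dimension $r$ and socle-vector $s$; $\text{min.emb.dim.}(s)$ is the least integer $r$ for which there exists an algebra with data $(r,s)$. An $h$-vector $h$ is admissible for $(r,s)$ if it is the $h$-vector of some algebra with data $(r,s)$. $h$-vectors of the same length are partially ordered entrywise: $h\geq h'$ if every entry of $h$ is $\geq$ the corresponding entry of $h'$. If there is an admissible $h$-vector $h$ for $(r,s)$ with $h\geq h'$ for every other admissible $h'$ (i.e. a maximum), then any algebra with data $(r,s)$ and $h$-vector $h$ is called a generalized compressed algebra for $(r,s)$. Notation: $N(r,d)=\dim_k R_d=\binom{r-1+d}{d}$ for $d\geq 0$. For $d=0,1,\dots,e$,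 $$r_d=N(r,d)-N(r,0)s_d-N(r,1)s_{d+1}-\dots-N(r,e-d)s_e.$$ For positive integers $n,i$, the $i$-binomial expansion of $n$ is the unique expression $n_{(i)}=\binom{n_i}{i}+\binom{n_{i-1}}{i-1}+\dots+\binom{n_j}{j}$ with $n_i>n_{i-1}>\dots>n_j\geq j\geq 1$; for an integer $a$, set $$(n_{(i)})_a^a=\binom{n_i+a}{i+a}+\binom{n_{i-1}+a}{i-1+a}+\dots+\binom{n_j+a}{j+a}.$$ *)

(* Defs.v *)
From HB Require Import structures.
From mathcomp Require Import all_boot all_order all_algebra.
From mathcomp Require Import generic_quotient ring_quotient.
From mathcomp.multinomials Require Import mpoly.

Set Implicit Arguments.
Unset Strict Implicit.
Unset Printing Implicit Defensive.

Import GRing.Theory.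
Local Open Scope ring_scope.
Local Open Scope quotient_scope.

(* The library makes {ideal_quot I} a commutative ring only; here it receives
   the k-algebra structure induced by the constant polynomials. *)
Section QuotientAlgebra.

Variables (k : fieldType) (r : nat) (I : idealr {mpoly k[r]}).
Local Notation A := {ideal_quot I}.

Definition quot_scale (c : k) (a : A) : A := \pi_A (c%:MP) * a.

Fact quot_scaleA c d a : quot_scale c (quot_scale d a) = quot_scale (c * d) a.
Proof. by rewrite /quot_scale mulrA -rmorphM -mpolyCM. Qed.

Fact quot_scale1 : left_id 1 quot_scale.
Proof. by move=> a; rewrite /quot_scale mpolyC1 rmorph1 mul1r. Qed.

Fact quot_scaleDr : right_distributive quot_scale +%R.
Proof. by move=> c a b; rewrite /quot_scale mulrDr. Qed.

Fact quot_scaleDl a : {morph quot_scale^~ a : c d / c + d}.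
Proof. by move=> c d; rewrite /quot_scale mpolyCD rmorphD mulrDl. Qed.

HB.instance Definition _ := GRing.Zmodule_isLmodule.Build k A
  quot_scaleA quot_scale1 quot_scaleDr quot_scaleDl.

Fact quot_scaleAl (c : k) (a b : A) : c *: (a * b) = c *: a * b.
Proof. exact: mulrA. Qed.

HB.instance Definition _ := GRing.Lmodule_isLalgebra.Build k A quot_scaleAl.

Fact quot_scaleAr (c : k) (a b : A) : c *: (a * b) = a * (c *: b).
Proof. exact: mulrCA. Qed.

HB.instance Definition _ := GRing.Lalgebra_isAlgebra.Build k A quot_scaleAr.

End QuotientAlgebra.

(* The subspace S of V has dimension n, i.e. a basis with n elements; V itself
   need not be finite dimensional. *)
Definition has_dim (k : fieldType) (V : lmodType k) (S : V -> Prop) (n : nat) :=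
  exists b : 'I_n -> V,
    (forall c : 'I_n -> k, \sum_(i < n) c i *: b i = 0 -> forall i, c i = 0) /\
    (forall v, S v <-> exists c : 'I_n -> k, v = \sum_(i < n) c i *: b i).

Section Pieces.

Variables (k : fieldType) (r : nat) (I : idealr {mpoly k[r]}).
Local Notation A := {ideal_quot I}.

Definition graded_piece (d : nat) (a : A) : Prop :=
  exists2 p : {mpoly k[r]}, p \is d.-homog & a = \pi_A p.

Definition max_homog_ideal (a : A) : Prop :=
  exists2 p : {mpoly k[r]}, p@_0%MM = 0 & a = \pi_A p.

Definition socle (a : A) : Prop := forall m : A, max_homog_ideal m -> a * m = 0.

Definition socle_piece (d : nat) (a : A) : Prop := socle a /\ graded_piece d a.

End Pieces.

(* Standard graded artinian algebras R/I = A_0 + ... + A_e, with R = k[x_1..x_r]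
   and A_e <> 0.  Since R/I is a finitely generated graded algebra, it is
   artinian exactly when its pieces vanish in all large degrees. *)
Record art_algebra (k : fieldType) (r e : nat) := ArtAlgebra {
  art_ideal :> idealr {mpoly k[r]};
  art_homogeneous : forall (p : {mpoly k[r]}) (d : nat),
    p \in art_ideal -> pihomog mdeg d p \in art_ideal;
  art_no_linear_form : forall p : {mpoly k[r]},
    p \is 1.-homog -> p \in art_ideal -> p = 0;
  art_top : exists2 a : {ideal_quot art_ideal}, graded_piece e a & a <> 0;
  art_above_top : forall (d : nat) (a : {ideal_quot art_ideal}),
    (e < d)%N -> graded_piece d a -> a = 0
}.

Local Open Scope nat_scope.

Section Vectors.

Variables (k : fieldType) (e : nat).
Implicit Types (r : nat) (s h : e.+1.-tuple nat).

Definition is_h_vector r (A : art_algebra k r e) h :=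
  forall i, i <= e -> has_dim (@graded_piece k r A i) (nth 0 h i).

Definition is_socle_vector r (A : art_algebra k r e) s :=
  forall i, i <= e -> has_dim (@socle_piece k r A i) (nth 0 s i).

Definition has_algebra r s := exists A : art_algebra k r e, is_socle_vector A s.

Definition is_min_emb_dim s (r0 : nat) :=
  has_algebra r0 s /\ forall r, has_algebra r s -> r0 <= r.

Definition admissible r s h :=
  exists A : art_algebra k r e, is_socle_vector A s /\ is_h_vector A h.

Definition is_max_admissible r s h :=
  admissible r s h /\
  forall h', admissible r s h' -> forall i, i <= e -> nth 0 h' i <= nth 0 h i.

Definition generalized_compressed r s (A : art_algebra k r e) :=
  is_socle_vector A s /\ exists2 h, is_max_admissible r s h & is_h_vector A h.

End Vectors.

Definition socle_type (e : nat) (s : e.+1.-tuple nat) : nat :=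
  \sum_(1 <= i < e.+1) nth 0 s i.

Definition N (r d : nat) : nat := 'C(r - 1 + d, d).

(* r_d; it may be negative. *)
Definition r_ (r e : nat) (s : e.+1.-tuple nat) (d : nat) : int :=
  (Posz (N r d) - \sum_(d <= j < e.+1) Posz (N r (j - d) * nth 0 s j)%N)%R.

(* m_i > ... > m_j are the upper entries of the i-binomial expansion of n; the
   values of m outside [j, i] are irrelevant. *)
Definition binomial_expansion (n i j : nat) (m : nat -> nat) :=
  [/\ 1 <= j <= i, j <= m j,
      forall l, j <= l < i -> m l < m l.+1
    & n = \sum_(j <= l < i.+1) 'C(m l, l)].

(* v = (n_(i))_a^a; the expansion exists and is unique for positive n and i. *)
Definition is_shifted_expansion (n i a v : nat) :=
  exists j m, binomial_expansion n i j m /\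
    v = \sum_(j <= l < i.+1) 'C(m l + a, l + a).

(* Main.v *)
(* Macaulay duality: the ideal of an algebra with socle in degrees [e] and [p]
   only, one generator in each ([p = e] for the socle-vector (0,...,0,2)),
   consists of the polynomials annihilating two functionals, one on forms of
   degree [e] and one on forms of degree [p]; then [h_i] is the rank of a matrix
   with [N(r,i)] rows and [N(r,e-i) + N(r,p-i)] columns.  If [p < e], the socle
   generator of degree [p] is a form killed by the first functional, and its
   multiples in degrees [i] and [e-i] improve the bound for [i > p].

   The bounds are attained.  If [e < 2p], let the functionals take the value
   1/(v+2), resp. 1/(v+3), on a monomial of weight [v], for weights which are
   additive and injective on monomials: the matrices are then Cauchy matrices,
   which have maximal rank.  If [2p <= e], let the first functional be the sum of
   the evaluations at the points (1 : b_1 : ... : b_(r-1)) with natural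
   coordinates, [b_1 < p] and sum at most [e/2]: it is killed by the product of
   the forms x_1 - s x_0 for [s < p], and, up to degree [e/2], by its multiples
   only, because these points separate forms. *)
From HB Require Import structures.
From mathcomp Require Import all_boot all_order all_algebra.
From mathcomp Require Import generic_quotient ring_quotient.
From mathcomp.multinomials Require Import mpoly.
From mathcomp Require Import zify.
Require Import Defs.

Set Implicit Arguments.
Unset Strict Implicit.
Unset Printing Implicit Defensive.

Import GRing.Theory.
Local Open Scope ring_scope.
Local Open Scope quotient_scope.

(** * Dimensions *)

Section Dimension.

Variables (k : fieldType) (V : lmodType k).
Implicit Types S : V -> Prop.

Lemma has_dim_basis S n (b : 'I_n -> V) :
  (forall v, S v <-> exists c : 'I_n -> k, v = \sum_(i < n) c i *: b i) ->
  forall i, S (b i).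
Proof.
move=> hS i; apply/hS; exists (fun j => (i == j)%:R).
rewrite (bigD1 i) //= eqxx scale1r big1 ?addr0 // => j.
by rewrite eq_sym => /negPf ->; rewrite scale0r.
Qed.

(** Coordinates turn linear dependencies in an abstract space into the left kernel of a matrix;
    later the columns of [C] are read as functionals. *)
Lemma has_dim_coordinates S n N (v : 'I_N -> V) :
  has_dim S n -> (forall j, S (v j)) ->
  exists C : 'M[k]_(N, n), forall c : 'rV_N,
    \sum_(j < N) c 0 j *: v j = 0 <-> c *m C = 0.
Proof.
case=> b [free_b span_b] Sv.
have /fin_all_exists [F hF] j : exists c : 'I_n -> k, v j = \sum_i c i *: b i.
  exact/span_b.
exists (\matrix_(j, i) F j i) => c.
have -> : \sum_j c 0 j *: v j = \sum_i (c *m \matrix_(j, i) F j i) 0 i *: b i.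
  under eq_bigr => j _ do rewrite hF scaler_sumr.
  rewrite exchange_big /=; apply: eq_bigr => i _; rewrite mxE scaler_suml.
  by apply: eq_bigr => j _; rewrite mxE scalerA.
split=> [/free_b h|->]; first by apply/rowP=> i; rewrite h mxE.
by rewrite big1 // => i _; rewrite mxE scale0r.
Qed.

Lemma has_dim_leq S n m : has_dim S n -> has_dim S m -> (n <= m)%N.
Proof.
move=> [b [free_b span_b]] dm.
have [C hC] := has_dim_coordinates dm (has_dim_basis span_b).
suff /eqP <- : row_free C by rewrite rank_leq_col.
apply: inj_row_free => c /hC /free_b h.
by apply/rowP=> i; rewrite h mxE.
Qed.

Lemma has_dim_uniq S n m : has_dim S n -> has_dim S m -> n = m.
Proof. by move=> h h'; apply/anti_leq; rewrite (has_dim_leq h h') (has_dim_leq h' h). Qed.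

Lemma has_dim_ext S S' n :
  (forall v, S v <-> S' v) -> has_dim S n -> has_dim S' n.
Proof.
move=> e [b [free_b span_b]]; exists b; split=> // v.
by split=> [/e/span_b|/span_b/e].
Qed.

(** Two linear maps with the same kernel have isomorphic images, so [S], the image of [f], is a copy
    of the row space of [M]. *)
Lemma has_dim_rank S N m (f : {linear 'rV[k]_N -> V}) (M : 'M[k]_(N, m)) :
  (forall v, S v <-> exists c, v = f c) ->
  (forall c, f c = 0 <-> c *m M = 0) ->
  has_dim S (\rank M).
Proof.
(* [B] lifts a basis of the row space of [M]; [f] sends its rows to a basis of [S]. *)
move=> span_f ker_f; pose B := row_base M *m pinvmx M.
have BM : B *m M = row_base M by rewrite mulmxKpV // eq_row_base.
have sumE (c : 'I_(\rank M) -> k) :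
    \sum_i c i *: f (row i B) = f ((\row_i c i) *m B).
  rewrite mulmx_sum_row linear_sum; apply: eq_bigr => i _.
  by rewrite linearZ mxE.
exists (fun i => f (row i B)); split.
  move=> c; rewrite sumE => /ker_f; rewrite -mulmxA BM => h i.
  have /rowP/(_ i) : \row_i c i = 0; last by rewrite !mxE.
  by apply: (row_free_inj (row_base_free M)); rewrite h mul0mx.
move=> v; rewrite span_f; split=> [[c ->]|[c ->]]; last first.
  by rewrite sumE; eexists.
have /submxP[d hd] : (c *m M <= row_base M)%MS by rewrite eq_row_base submxMl.
exists (d 0); rewrite sumE; apply/eqP; rewrite -subr_eq0 -linearB; apply/eqP/ker_f.
have -> : \row_i d 0 i = d by apply/rowP=> i; rewrite mxE.
by rewrite mulmxBl -mulmxA BM hd subrr.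
Qed.

Lemma has_dim_zero S : (forall v, S v <-> v = 0) -> has_dim S 0.
Proof.
move=> S0; exists (fun => 0); split=> [c _ []//|v]; rewrite S0.
by split=> [->|[c ->]]; [exists (fun => 0)|]; rewrite big_ord0.
Qed.

End Dimension.

(** * Forms of fixed degree, functionals and catalecticant matrices *)

Section Monomials.

Variable n : nat.
Local Notation N := (N n.+1).

Definition mon_seq d : seq 'X_{1..n.+1} :=
  [seq s2m t | t : d.-tuple 'I_n.+1 <- enum (basis n.+1 d)].

Definition mon d (i : 'I_(N d)) : 'X_{1..n.+1} := nth 0%MM (mon_seq d) i.

Lemma size_mon_seq d : size (mon_seq d) = N d.
Proof. by rewrite size_basis /Defs.N subSS subn0 addnC. Qed.

Lemma mdeg_mon d (i : 'I_(N d)) : mdeg (mon i) = d.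
Proof. by apply/eqP; rewrite basis_cover mem_nth // size_mon_seq. Qed.

Lemma mon_inj d : injective (@mon d).
Proof.
move=> i j /eqP; rewrite nth_uniq ?size_mon_seq ?uniq_basis // => /eqP.
exact: val_inj.
Qed.

Lemma mon_surj d (m : 'X_{1..n.+1}) : mdeg m = d -> exists i : 'I_(N d), m = mon i.
Proof.
move=> /eqP; rewrite basis_cover -/(mon_seq d) => h.
have lt : (index m (mon_seq d) < N d)%N by rewrite -size_mon_seq index_mem.
by exists (Ordinal lt); rewrite /mon nth_index.
Qed.

End Monomials.

Section Forms.

Variables (k : fieldType) (n : nat).
Local Notation N := (N n.+1).
Local Notation R := {mpoly k[n.+1]}.
Implicit Types (l : 'X_{1..n.+1} -> k) (f q : R).

Definition form d (c : 'rV[k]_(N d)) : R := \sum_(i < N d) c 0 i *: 'X_[mon i].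

Fact form_is_linear d : linear (@form d).
Proof.
move=> a c c'; rewrite /form scaler_sumr -big_split; apply: eq_bigr => i _ /=.
by rewrite !mxE scalerDl scalerA.
Qed.

HB.instance Definition _ d :=
  GRing.isLinear.Build k 'rV[k]_(N d) R _ (@form d) (@form_is_linear d).

Lemma form_homog d (c : 'rV_(N d)) : form c \is d.-homog.
Proof.
apply: rpred_sum => i _; apply: rpredZ.
by rewrite dhomogX; apply/eqP/mdeg_mon.
Qed.

Lemma mcoeff_form d (c : 'rV_(N d)) i : (form c)@_(mon i) = c 0 i.
Proof.
rewrite linear_sum (bigD1 i) //= mcoeffZ mcoeffX eqxx mulr1 big1 ?addr0 // => j ji.
by rewrite mcoeffZ mcoeffX (inj_eq (@mon_inj _ _)) (negPf ji) mulr0.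
Qed.

Lemma homog_form d f : f \is d.-homog -> f = form (\row_(i < N d) f@_(mon i)).
Proof.
move=> hf; apply/mpolyP => m.
have [hm|hm] := eqVneq (mdeg m) d.
  by have [i ->] := mon_surj hm; rewrite mcoeff_form mxE.
by rewrite (dhomog_nemf_coeff hf hm) (dhomog_nemf_coeff (form_homog _) hm).
Qed.

(** [l] lists the values of a functional on monomials. Only degree [d] counts, so that arbitrary
    polynomials may be paired with it. *)
Definition apolar d l f : k := \sum_(i < N d) f@_(mon i) * l (mon i).

Fact apolar_is_linear d l : linear_for *%R (apolar d l).
Proof.
move=> a f g; rewrite /apolar mulr_sumr -big_split; apply: eq_bigr => i _ /=.
by rewrite mcoeffD mcoeffZ mulrDl mulrA.
Qed.

HB.instance Definition _ d l :=
  GRing.isLinear.Build k R k _ (apolar d l) (apolar_is_linear d l).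

Lemma apolarX d l m : apolar d l 'X_[m] = if mdeg m == d then l m else 0.
Proof.
case: eqP => [hm|hm]; rewrite /apolar.
  have [i ->] := mon_surj hm; rewrite (bigD1 i) //= mcoeffX eqxx mul1r.
  rewrite big1 ?addr0 // => j ji.
  by rewrite mcoeffX (inj_eq (@mon_inj _ _)) eq_sym (negPf ji) mul0r.
rewrite big1 // => i _; rewrite mcoeffX; case: eqP => [e|_]; last by rewrite mul0r.
by case: hm; rewrite e mdeg_mon.
Qed.

Lemma apolar_homog d d' l f : f \is d'.-homog -> d' != d -> apolar d l f = 0.
Proof.
move=> hf nd; rewrite /apolar big1 // => i _.
by rewrite (dhomog_nemf_coeff hf) ?mul0r //= mdeg_mon eq_sym.
Qed.

(** By linearity [q] may be a monomial, and beyond degree [d] the product has no component of degree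
    [d]. *)
Lemma apolar_monomials d l f :
  (forall m, (mdeg m <= d)%N -> apolar d l (f * 'X_[m]) = 0) ->
  forall q, apolar d l (f * q) = 0.
Proof.
move=> h q; rewrite [q]mpolyE mulr_sumr linear_sum big1 // => m _ /=.
rewrite -scalerAr linearZ /=.
case: (leqP (mdeg m) d) => hm; first by rewrite h ?mulr0.
rewrite [f]mpolyE mulr_suml linear_sum big1 ?mulr0 //= => m' _.
rewrite -scalerAl -mpolyXD linearZ /= apolarX mdegD.
by case: eqP hm => [<-|_]; rewrite ?mulr0 // ltnNge leq_addl.
Qed.

(* The monomial of degree [d - i] is multiplied into one of degree [i], so that
   the matrix is zero when [d < i]. *)
Definition catalecticant d l i : 'M[k]_(N i, N (d - i)) :=
  \matrix_(a, b) apolar d l ('X_[mon a] * 'X_[mon b]).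

Lemma mul_catalecticant d l i (c : 'rV_(N i)) b :
  (c *m catalecticant d l i) 0 b = apolar d l (form c * 'X_[mon b]).
Proof.
rewrite mxE mulr_suml linear_sum; apply: eq_bigr => a _ /=.
by rewrite -scalerAl linearZ mxE.
Qed.

(** The columns test only monomials of degree [d - i]; with any other monomial the product has
    degree different from [d], hence value zero. *)
Lemma catalecticant_ker d l i (c : 'rV_(N i)) :
  c *m catalecticant d l i = 0 <-> forall q, apolar d l (form c * q) = 0.
Proof.
split=> [h|h]; last by apply/rowP => b; rewrite mul_catalecticant h mxE.
apply: apolar_monomials => m hm.
have [e|ne] := eqVneq (i + mdeg m)%N d; last first.
  apply: apolar_homog ne; apply: dhomogM; first exact: form_homog.
  by rewrite dhomogX.
have hm' : mdeg m = (d - i)%N by rewrite -e addKn.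
by have [b ->] := mon_surj hm'; rewrite -mul_catalecticant h mxE.
Qed.

Lemma catalecticant0 d l i : (d < i)%N -> catalecticant d l i = 0.
Proof.
move=> di; apply/matrixP => a b; rewrite !mxE -mpolyXD apolarX mdegD !mdeg_mon.
by case: eqP => // e; move: di; rewrite -[in X in (X < _)%N]e ltnNge leq_addr.
Qed.

Lemma catalecticantE d l i a b : (i <= d)%N ->
  catalecticant d l i a b = l (mon a + mon b)%MM.
Proof.
by move=> id; rewrite mxE -mpolyXD apolarX mdegD !mdeg_mon subnKC // eqxx.
Qed.

End Forms.

(** * Inverse systems *)

Section Classes.

Variables (k : fieldType) (n : nat) (I : idealr {mpoly k[n.+1]}).
Local Notation N := (N n.+1).
Local Notation R := {mpoly k[n.+1]}.
Local Notation A := {ideal_quot I}.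

Lemma class_eq0 (f : R) : \pi_A f = 0 <-> f \in I.
Proof.
rewrite -[f in X in _ <-> X]subr0 Quotient.idealrBE pi_zeror.
by split=> [->|/eqP].
Qed.

Definition form_class d (c : 'rV[k]_(N d)) : A := \pi_A (form c).

Fact form_class_is_linear d : linear (@form_class d).
Proof.
move=> a c c'; rewrite /form_class linearD linearZ /= rmorphD -mul_mpolyC.
by rewrite rmorphM.
Qed.

HB.instance Definition _ d :=
  GRing.isLinear.Build k 'rV[k]_(N d) A _ (@form_class d) (@form_class_is_linear d).

Lemma graded_pieceE d a :
  graded_piece d a <-> exists c : 'rV_(N d), a = form_class c.
Proof.
split=> [[f hf ->]|[c ->]]; last by exists (form c) => //; apply: form_homog.
by exists (\row_(i < N d) f@_(mon i)); rewrite /form_class -homog_form.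
Qed.

Lemma socle_monomials (f : R) :
  socle (\pi_A f) <-> forall m, m != 0%MM -> f * 'X_[m] \in I.
Proof.
split=> h.
  move=> m nz; apply/class_eq0; rewrite rmorphM; apply: h.
  by exists 'X_[m] => //; rewrite mcoeffX (negPf nz).
move=> _ [q q0 ->]; rewrite -rmorphM; apply/class_eq0.
rewrite [q]mpolyE mulr_sumr big_seq; apply: rpred_sum => m.
rewrite mcoeff_msupp => mq; rewrite -scalerAr -mul_mpolyC.
by apply/idealMr/h; apply: contraNneq mq => ->; rewrite q0.
Qed.

Lemma graded_coordinates d m :
  has_dim (@graded_piece _ _ I d) m ->
  exists C : 'M[k]_(N d, m), forall c, form_class c = 0 <-> c *m C = 0.
Proof.
move=> hd.
have Sv (j : 'I_(N d)) : graded_piece d (\pi_A 'X_[mon j]).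
  by exists 'X_[mon j] => //; rewrite dhomogX; apply/eqP/mdeg_mon.
have [C hC] := has_dim_coordinates hd Sv.
exists C => c; rewrite -hC /form_class /form rmorph_sum /=.
rewrite (eq_bigr (fun j => c 0 j *: \pi_A 'X_[mon j])) // => j _.
by rewrite -mul_mpolyC rmorphM.
Qed.

End Classes.

Section Duality.

Variables (k : fieldType) (n e p : nat) (l1 l2 : 'X_{1..n.+1} -> k).
Local Notation N := (N n.+1).
Local Notation R := {mpoly k[n.+1]}.

Definition annihilates (f : R) :=
  (forall q, apolar e l1 (f * q) = 0) /\ (forall q, apolar p l2 (f * q) = 0).

(* [I] is the ideal with inverse system generated by [l1] and [l2]; only its
   homogeneous elements matter. *)
Definition dual_ideal (I : idealr R) :=
  forall i f, f \is i.-homog -> (f \in I <-> annihilates f).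

Definition hankel i := row_mx (catalecticant e l1 i) (catalecticant p l2 i).

Lemma annihilates_form i (c : 'rV_(N i)) :
  annihilates (form c) <-> c *m hankel i = 0.
Proof.
rewrite mul_mx_row -[0]row_mx0; split=> [[h1 h2]|/eq_row_mx[]].
  by congr row_mx; apply/catalecticant_ker.
by split; apply/catalecticant_ker.
Qed.

Section DualIdeal.

Variables (I : idealr R) (dualI : dual_ideal I).

Lemma form_class_eq0 i (c : 'rV_(N i)) :
  form_class I c = 0 <-> c *m hankel i = 0.
Proof.
by rewrite -annihilates_form -(dualI (form_homog c)); apply: class_eq0.
Qed.

Lemma graded_piece_dim i : has_dim (@graded_piece _ _ I i) (\rank (hankel i)).
Proof.
apply: (has_dim_rank (f := @form_class _ _ I i)) => [v|c].
  exact: graded_pieceE.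
exact: form_class_eq0.
Qed.

(** The form is in the socle when its multiples by all monomials other than 1 are annihilated. A
    functional of degree [j] gives no condition, since these multiples have larger degree. For the
    other degrees the missing test against 1 is automatic, so the form itself is killed. *)
Lemma socle_form j (c : 'rV_(N j)) : socle (form_class I c) <->
  (j != e -> c *m catalecticant e l1 j = 0) /\
  (j != p -> c *m catalecticant p l2 j = 0).
Proof.
rewrite /form_class socle_monomials.
have above l m (m0 : m != 0%MM) q : apolar j l (form c * 'X_[m] * q) = 0.
  apply: apolar_monomials => m' hm'; rewrite -mulrA -mpolyXD.
  apply: (@apolar_homog _ _ j (j + mdeg (m + m'))).
    by apply: dhomogM; [exact: form_homog|rewrite dhomogX].
  by rewrite -[X in _ != X]addn0 eqn_add2l mdegD addn_eq0 mdeg_eq0 (negPf m0).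
have homX m : form c * 'X_[m] \is (j + mdeg m).-homog.
  by apply: dhomogM; [exact: form_homog|rewrite dhomogX].
have zero d l : (forall m, m != 0%MM -> apolar d l (form c * 'X_[m]) = 0) ->
    j != d -> c *m catalecticant d l j = 0.
  move=> h jd; apply/catalecticant_ker/apolar_monomials => m _.
  have [->|/h//] := eqVneq m 0%MM.
  by apply: apolar_homog jd; rewrite mpolyX0 mulr1; apply: form_homog.
split=> [h|[h1 h2] m m0].
  split; apply: zero => m /h /(dualI (homX m)) [a1 a2].
    by have := a1 1; rewrite mulr1.
  by have := a2 1; rewrite mulr1.
apply/(dualI (homX m)); split=> q.
  have [<-|/h1 /catalecticant_ker] := eqVneq j e; first exact: above.
  by rewrite -mulrA.
have [<-|/h2 /catalecticant_ker] := eqVneq j p; first exact: above.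
by rewrite -mulrA.
Qed.

(** In degree [e] everything is socle; in degree [p < e] the socle consists of the classes of the
    forms killed by [l1]; elsewhere a socle form is annihilated, hence zero in the quotient. *)
Lemma socle_piece_dim s :
  (p <= e)%N -> \rank (hankel e) = (1 + (p == e))%N ->
  ((p < e)%N -> exists c : 'rV_(N p),
     c *m catalecticant e l1 p = 0 /\ c *m catalecticant p l2 p != 0) ->
  (forall j, (j <= e)%N -> s j = ((j == e) + (j == p))%N) ->
  forall j, (j <= e)%N -> has_dim (@socle_piece _ _ I j) (s j).
Proof.
move=> pe rk_e ex_c sE j je; rewrite {}sE //.
have [->|ne] := eqVneq j e.
  rewrite eq_sym -rk_e; apply: has_dim_ext (graded_piece_dim e) => a.
  split=> [ga|[]//]; split=> //; have [c ->] := (graded_pieceE _ _).1 ga.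
  apply/socle_form; rewrite eqxx; split=> // ep.
  by rewrite catalecticant0 ?mulmx0 // ltn_neqAle eq_sym ep.
have [jp|np] := eqVneq j p; last first.
  apply: has_dim_zero => a; split=> [[sa ga]|->].
    have [c ac] := (graded_pieceE _ _).1 ga; move: sa; rewrite ac.
    move=> /socle_form [h1 h2]; apply/form_class_eq0.
    by rewrite mul_mx_row h1 ?h2 ?row_mx0.
  split=> [x _|]; first by rewrite mul0r.
  by apply/graded_pieceE; exists 0; rewrite linear0.
move: je ne; rewrite {}jp => _ ne.
have lt_pe : (p < e)%N by rewrite ltn_neqAle ne.
pose K := kermx (catalecticant e l1 p).
have <- : \rank (K *m hankel p) = (false + true)%N.
  (* The second block has [N 0 = 1] column, so the dimension is at most 1; [ex_c] gives the
     converse. *)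
  rewrite mul_mx_row mulmx_ker rank_row_0mx; apply/eqP; rewrite eqn_leq.
  apply/andP; split.
    by apply: leq_trans (rank_leq_col _) _; rewrite subnn /Defs.N bin0.
  rewrite lt0n mxrank_eq0; have [c [c1 c2]] := ex_c lt_pe.
  apply: contraNneq c2 => K0; have /sub_kermxP/submxP[d ->] := c1.
  by rewrite -mulmxA K0 mulmx0.
apply: (has_dim_rank (f := @form_class _ _ I p \o mulmxr K)) => [a|c] /=.
  split=> [[sa ga]|[c ->]].
    have [c ac] := (graded_pieceE _ _).1 ga; move: sa; rewrite ac.
    move=> /socle_form [/(_ ne) /sub_kermxP/submxP[d ->] _].
    by exists d.
  split; last by apply/graded_pieceE; eexists.
  apply/socle_form; rewrite eqxx; split=> // _.
  by rewrite -mulmxA mulmx_ker mulmx0.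
by rewrite form_class_eq0 mulmxA.
Qed.

End DualIdeal.

Section Existence.

Hypotheses (pe : (p <= e)%N) (free1 : row_free (hankel 1)).
Hypothesis top : hankel e != 0.

(** Monomials of degree at most [e] suffice because [p <= e]; this finite test makes the predicate
    boolean. *)
Definition annihilator : pred R := fun f =>
    [forall m : 'X_{1..n.+1 < e.+1},
      (apolar e l1 (f * 'X_[m]) == 0) && (apolar p l2 (f * 'X_[m]) == 0)].

Lemma annihilatesP f :
  reflect (annihilates f) (annihilator f).
Proof.
apply: (iffP forallP) => [h|[h1 h2] m]; last by rewrite h1 h2 eqxx.
have h' m : (mdeg m <= e)%N ->
    apolar e l1 (f * 'X_[m]) = 0 /\ apolar p l2 (f * 'X_[m]) = 0.
  by rewrite -ltnS => hm; have /andP[/eqP ? /eqP ?] := h (BMultinom hm).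
split; apply: apolar_monomials => m hm; first by case: (h' m).
by case: (h' m) => //; apply: leq_trans pe.
Qed.

Lemma exists_form_top : exists c : 'rV_(N e), c *m hankel e != 0.
Proof.
have [i hi|h] := pickP (fun i => row i (hankel e) != 0).
  by exists (delta_mx 0 i); rewrite -rowE.
case/eqP: top; apply/row_matrixP => i; rewrite row0; apply/eqP.
by move/(_ i)/negbFE: h.
Qed.

Lemma annihilator_idealr : idealr_closed annihilator.
Proof.
split.
- by apply/annihilatesP; split=> q; rewrite mul0r linear0.
- apply/annihilatesP => -[h1 h2]; have [c /eqP] := exists_form_top; apply.
  by apply/annihilates_form; split=> q; rewrite -[_ * _]mul1r ?h1 ?h2.
move=> a f g /annihilatesP[f1 f2] /annihilatesP[g1 g2]; apply/annihilatesP.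
by split=> q; rewrite mulrDl linearD /= [a * f]mulrC -mulrA ?f1 ?f2 ?g1 ?g2 add0r.
Qed.

Definition annihilator_ideal : idealr R :=
  HB.pack_for (idealr R) annihilator
    (isIdealr.Build R annihilator annihilator_idealr).

Lemma apolar_pihomog_monomial d (l : _ -> k) i (f : R) m :
  apolar d l (pihomog mdeg i f * 'X_[m]) =
    if (i + mdeg m)%N == d then apolar d l (f * 'X_[m]) else 0.
Proof.
case: eqP => [e1|/eqP ne]; last first.
  apply: apolar_homog ne; apply: dhomogM; first exact: pihomogP.
  by rewrite dhomogX.
rewrite [f in RHS]mpolyE (pihomogE mdeg i f) !mulr_suml !linear_sum /=.
rewrite big_mkcond; apply: eq_bigr => m' _; case: eqP => // ne.
rewrite -scalerAl linearZ /= -mpolyXD apolarX mdegD -e1 eqn_add2r.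
by case: eqP => //; rewrite mulr0.
Qed.

(** [free1] keeps linear forms out of the ideal, [top] makes degree [e] nonzero, and above degree
    [e] both catalecticant matrices vanish. *)
Lemma exists_dual_algebra :
  exists A : art_algebra k n.+1 e, dual_ideal A.
Proof.
have dualI : dual_ideal annihilator_ideal.
  by move=> i f _; split=> /annihilatesP.
unshelve eexists.
  apply: (@ArtAlgebra _ _ _ annihilator_ideal).
  - move=> f d /annihilatesP[f1 f2]; apply/annihilatesP.
    split; apply: apolar_monomials => m _; rewrite apolar_pihomog_monomial.
      by rewrite f1 if_same.
    by rewrite f2 if_same.
  - move=> f hf /(dualI _ _ hf); rewrite (homog_form hf).
    move=> /annihilates_form; rewrite -[0](mul0mx _ (hankel 1)).
    by move/(row_free_inj free1) ->; rewrite linear0.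
  - have [c hc] := exists_form_top; exists (form_class annihilator_ideal c).
      by apply/graded_pieceE; exists c.
    by move=> /(form_class_eq0 dualI)/eqP; apply/negP.
  - move=> d a ed /graded_pieceE[c ->]; apply/(form_class_eq0 dualI).
    by rewrite mul_mx_row !catalecticant0 ?mulmx0 ?row_mx0 // (leq_ltn_trans pe).
exact: dualI.
Qed.

End Existence.

End Duality.

(** * Macaulay duality: recovering two functionals from the algebra *)

Section Macaulay.

Variables (k : fieldType) (n e : nat) (A : art_algebra k n.+1 e).
Local Notation N := (N n.+1).
Local Notation R := {mpoly k[n.+1]}.
Local Notation Q := {ideal_quot A}.

Lemma above_top d (f : R) : f \is d.-homog -> (e < d)%N -> f \in (A : idealr R).
Proof.
move=> hf ed; apply/class_eq0; apply: (art_above_top ed).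
by exists f.
Qed.

(** Multiply by nontrivial monomials as long as the product stays outside the ideal. Degrees are
    bounded by [e], so this stops, and it stops in the socle. *)
Lemma multiple_in_socle d (f : R) : f \is d.-homog -> f \notin (A : idealr R) ->
  exists m, f * 'X_[m] \notin (A : idealr R) /\ socle (\pi_Q (f * 'X_[m])).
Proof.
elim: {d}(e.+1 - d)%N {-2}d (leqnn (e.+1 - d)) f => [|b IH] d hd f hf fA.
  by case/negP: fA; apply: above_top hf _; lia.
(* Monomials of larger degree lead into the ideal anyway, so a bounded, decidable search
   suffices. *)
have [/existsP[m /andP[m0 hm]]|/existsPn h] :=
  boolP [exists m : 'X_{1..n.+1 < e.+2},
    ((m : 'X_{1..n.+1}) != 0%MM) && (f * 'X_[m] \notin (A : idealr R))].
  have hfm : f * 'X_[m] \is (d + mdeg m).-homog.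
    by apply: dhomogM; rewrite ?dhomogX.
  have [|m' []] := IH _ _ _ hfm hm.
    by move: m0; rewrite -mdeg_eq0; lia.
  by rewrite -mulrA -mpolyXD => h1 h2; exists (m + m')%MM.
exists 0%MM; rewrite mpolyX0 mulr1; split=> //; apply/socle_monomials => m m0.
case: (ltnP (mdeg m) e.+2) => hm.
  by have := h (BMultinom hm); rewrite /= m0 negbK.
apply: (@above_top (d + mdeg m)); last by lia.
by apply: dhomogM; rewrite ?dhomogX.
Qed.

Lemma apolar_of_column d m (C : 'M[k]_(N d, m)) t :
  exists l, forall c, apolar d l (form c) = (c *m C) 0 t.
Proof.
exists (fun m => \sum_(j < N d | mon j == m) C j t) => c.
rewrite mxE; apply: eq_bigr => i _; rewrite mcoeff_form; congr (_ * _).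
by rewrite (eq_bigl (pred1 i)) ?big_pred1_eq // => j; rewrite (inj_eq (@mon_inj _ _)).
Qed.

(** A form outside the ideal has a multiple with nonzero class in the socle, which one of the
    functionals detects. *)
Lemma dual_of_separating p l1 l2 :
  (forall c : 'rV_(N e), form c \in (A : idealr R) -> apolar e l1 (form c) = 0) ->
  (forall c : 'rV_(N p), form c \in (A : idealr R) -> apolar p l2 (form c) = 0) ->
  (forall j f, f \is j.-homog -> f \notin (A : idealr R) -> socle (\pi_Q f) ->
     apolar e l1 f != 0 \/ apolar p l2 f != 0) ->
  dual_ideal e p l1 l2 A.
Proof.
move=> v1 v2 sep i f hf; split=> [fA|[h1 h2]]; last first.
  have [//|fA] := boolP (f \in (A : idealr R)).
  have [m [fmA sm]] := multiple_in_socle hf fA.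
  have hfm : f * 'X_[m] \is (i + mdeg m).-homog.
    by apply: dhomogM; rewrite ?dhomogX.
  by case: (sep _ _ hfm fmA sm) => /eqP; rewrite ?h1 ?h2.
have ann d l : (forall c : 'rV_(N d), form c \in (A : idealr R) ->
    apolar d l (form c) = 0) -> forall q, apolar d l (f * q) = 0.
  move=> v; apply: apolar_monomials => m _.
  have hfm : f * 'X_[m] \is (i + mdeg m).-homog.
    by apply: dhomogM; rewrite ?dhomogX.
  have [ed|ne] := eqVneq (i + mdeg m)%N d; last exact: apolar_homog hfm ne.
  rewrite ed in hfm; rewrite (homog_form hfm); apply: v.
  by rewrite -homog_form // mulrC idealMr.
by split; apply: ann.
Qed.

Lemma macaulay_dual p (s : nat -> nat) m : (p <= e)%N ->
  (forall j, (j <= e)%N -> has_dim (@socle_piece _ _ A j) (s j)) ->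
  (forall j, (j <= e)%N -> s j = ((j == e) + (j == p))%N) ->
  has_dim (@graded_piece _ _ A p) m ->
  exists l1 l2, dual_ideal e p l1 l2 A.
Proof.
move=> pe soc sE dim_p.
have soc_e : has_dim (@graded_piece _ _ A e) (1 + (e == p)).
  move: (soc e (leqnn _)); rewrite sE // eqxx; apply: has_dim_ext => a.
  split=> [[]//|ga]; split=> //; have [f hf af] := ga; rewrite af.
  apply/socle_monomials => m' m'0; apply: (@above_top (e + mdeg m')).
    by apply: dhomogM; rewrite ?dhomogX.
  by move: m'0; rewrite -mdeg_eq0; lia.
have soc0 j f : f \is j.-homog -> f \notin (A : idealr R) -> socle (\pi_Q f) ->
    j = e \/ j = p.
  move=> hf fA sf; have [->|je] := eqVneq j e; first by left.
  have [->|jp] := eqVneq j p; first by right.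
  have le_je : (j <= e)%N.
    by rewrite leqNgt; apply: contra fA => /(above_top hf).
  have := soc j le_je; rewrite sE // (negPf je) (negPf jp) => -[b [_ hb]].
  case/negP: fA; apply/class_eq0; have [|c ->] := (hb (\pi_Q f)).1.
    by split=> //; exists f.
  by rewrite big_ord0.
have [C hC] := graded_coordinates soc_e.
have {}hC (c : 'rV_(N e)) : form c \in (A : idealr R) <-> c *m C = 0.
  by rewrite -hC; split=> /class_eq0.
have [l1 hl1] := apolar_of_column C 0.
have v1 (c : 'rV_(N e)) : form c \in (A : idealr R) -> apolar e l1 (form c) = 0.
  by rewrite hl1 => /hC ->; rewrite mxE.
(* If [p = e], the two coordinates on the top piece serve as functionals. *)
have [ep|ne] := eqVneq e p.
  subst p; rewrite eqxx in C hC hl1.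
  have [l2 hl2] := apolar_of_column C 1.
  exists l1, l2; apply: dual_of_separating => //.
    by move=> c; rewrite hl2 => /hC ->; rewrite mxE.
  move=> j f hf fA sf; have je : j = e by case: (soc0 _ _ hf fA sf).
  move: fA; rewrite je in hf; rewrite (homog_form hf).
  set c := \row__ _ => /negP fA; rewrite hl1 hl2.
  have [h1|] := eqVneq ((c *m C) 0 0) 0; last by left.
  right; apply/eqP => h2; apply: fA; apply/hC/rowP => i; rewrite [RHS]mxE.
  case: i => -[|[|//]] lt_i; [rewrite -[RHS]h1|rewrite -[RHS]h2];
    by congr (fun_of_matrix _ _ _); apply: val_inj.
have : has_dim (@socle_piece _ _ A p) 1.
  by move: (soc p pe); rewrite sE // eqxx eq_sym (negPf ne).
rewrite (negPf ne) in C hC hl1.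
case=> b [free_b span_b].
have [[sb gb] b0] : socle_piece p (b ord0) /\ b ord0 <> 0.
  split; first exact: has_dim_basis span_b _.
  move=> b0; case/eqP: (oner_neq0 k); apply: (free_b (fun => 1) _ ord0).
  by rewrite big_ord1 b0 scaler0.
have [g bE] := (graded_pieceE _ _).1 gb.
have [D hD] := graded_coordinates dim_p.
(* Any coordinate in degree [p] that is nonzero at the socle generator [g] will do for [l2]: every
   socle form of degree [p] is a multiple of [g] modulo the ideal. *)
have [t ht] : exists t, (g *m D) 0 t != 0.
  have [t ht|h] := pickP (fun t => (g *m D) 0 t != 0); first by exists t.
  case: b0; rewrite bE; apply/hD/rowP => t; rewrite [RHS]mxE; apply/eqP.
  by move/(_ t)/negbFE: h.
have [l2 hl2] := apolar_of_column D t.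
exists l1, l2; apply: dual_of_separating => //.
  by move=> c /class_eq0 /hD; rewrite hl2 => ->; rewrite mxE.
move=> j f hf fA sf; have [je|jp] := soc0 _ _ hf fA sf; [left|right].
  move: fA; rewrite je in hf; rewrite (homog_form hf).
  set c := \row__ _ => /negP fA; rewrite hl1; apply/eqP => h1; apply: fA.
  by apply/hC/rowP => i; rewrite ord1 h1 mxE.
move: fA sf; rewrite jp in hf; rewrite (homog_form hf).
set c := \row__ _ => fA sf; rewrite hl2; have [|a] := (span_b (form_class A c)).1.
  by split=> //; apply/graded_pieceE; exists c.
rewrite big_ord1 bE -linearZ /= => /eqP; rewrite -subr_eq0 -linearB => /eqP/hD.
rewrite mulmxBl -scalemxAl => /eqP; rewrite subr_eq0 => /eqP cD.
rewrite cD mxE mulf_neq0 //; apply: contraNneq fA => a0; apply/class_eq0/hD.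
by rewrite cD a0 scale0r.
Qed.

End Macaulay.

(** * Upper bounds *)

Section CatalecticantRank.

Variables (k : fieldType) (n : nat).
Local Notation N := (N n.+1).
Local Notation R := {mpoly k[n.+1]}.

Lemma catalecticant_sym d (l : 'X_{1..n.+1} -> k) i : (i <= d)%N ->
  \rank (catalecticant d l (d - i)) = \rank (catalecticant d l i).
Proof.
move=> id; pose H i j := \matrix_(a < N i, b < N j) l (mon a + mon b)%MM.
have HE j : (j <= d)%N -> catalecticant d l j = H j (d - j)%N.
  by move=> jd; apply/matrixP => a b; rewrite catalecticantE // mxE.
rewrite !HE ?leq_subr // subKn // -mxrank_tr.
by congr (\rank _); apply/matrixP => a b; rewrite !mxE addmC.
Qed.

Lemma rank_leq_corank m1 m2 m3 (K : 'M[k]_(m1, m2)) (M : 'M[k]_(m2, m3)) :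
  row_free K -> K *m M = 0 -> (\rank M + m1 <= m2)%N.
Proof.
move=> /eqP rkK /eqP; rewrite -sub_kermx => /mxrankS; rewrite mxrank_ker rkK.
by have := rank_leq_row M; lia.
Qed.

(* The left kernel contains the multiples of the form [g]. *)
Lemma catalecticant_rank_multiples d (l : 'X_{1..n.+1} -> k) p (g : 'rV[k]_(N p)) i :
  g != 0 -> g *m catalecticant d l p = 0 -> (p <= i)%N ->
  (\rank (catalecticant d l i) + N (i - p) <= N i)%N.
Proof.
move=> g0 gl pi.
(* The rows of [K] are the products of [g] with monomials; they are independent because the
   polynomial ring is a domain. *)
pose K := \matrix_(a < N (i - p), b < N i) ('X_[mon a] * form g)@_(mon b).
have rowK (c : 'rV_(N (i - p))) : form (c *m K) = form c * form g.
  have hom : form c * form g \is i.-homog.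
    by rewrite -[X in X.-homog](subnK pi); apply: dhomogM; apply: form_homog.
  rewrite [RHS](homog_form hom); congr form; apply/rowP => b; rewrite !mxE.
  rewrite mulr_suml linear_sum; apply: eq_bigr => a _ /=.
  by rewrite mxE -scalerAl mcoeffZ.
have form_inj d' (c : 'rV_(N d')) : form c = 0 -> c = 0.
  by move=> c0; apply/rowP => a; rewrite -mcoeff_form c0 mcoeff0 mxE.
apply: (@rank_leq_corank _ _ _ K).
  apply: inj_row_free => c cK; apply/form_inj/eqP.
  have /eqP : form c * form g = 0 by rewrite -rowK cK linear0.
  rewrite mulf_eq0 => /orP[//|/eqP/form_inj g00].
  by rewrite g00 eqxx in g0.
apply/row_matrixP => a; rewrite row0 row_mul rowE; apply/catalecticant_ker => q.
by rewrite rowK mulrAC mulrC; apply/(catalecticant_ker _ _ _).1.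
Qed.

End CatalecticantRank.

Section UpperBounds.

Variables (k : fieldType) (n e p : nat) (l1 l2 : 'X_{1..n.+1} -> k).
Variables (I : idealr {mpoly k[n.+1]}) (dualI : dual_ideal e p l1 l2 I).
Local Notation N := (N n.+1).

Lemma hankel_rank_gt i : (p < i)%N ->
  \rank (hankel e p l1 l2 i) = \rank (catalecticant e l1 i).
Proof. by move=> pi; rewrite /hankel (catalecticant0 l2 pi) rank_row_mx0. Qed.

(** For [p < i] truncated subtraction still gives the second block one column, but it is zero and is
    not counted. *)
Lemma hankel_rank_leq i :
  (\rank (hankel e p l1 l2 i) <=
     minn (N i) (N (e - i) + if i <= p then N (p - i) else 0))%N.
Proof.
rewrite leq_min rank_leq_row; case: (leqP i p) => [_|pi]; first exact: rank_leq_col.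
by rewrite hankel_rank_gt // addn0 rank_leq_col.
Qed.

Lemma socle_generator : (p < e)%N -> has_dim (@socle_piece _ _ I p) 1 ->
  exists2 g : 'rV_(N p), g != 0 & g *m catalecticant e l1 p = 0.
Proof.
move=> pe [b [free_b span_b]].
have [sb gb] := has_dim_basis span_b ord0.
have [g bE] := (graded_pieceE _ _).1 gb; rewrite bE in sb; exists g.
  apply: contraTneq (oner_neq0 k) => g0; rewrite negbK; apply/eqP.
  by apply: (free_b (fun => 1) _ ord0); rewrite big_ord1 bE g0 linear0 scaler0.
by apply: ((socle_form dualI _).1 sb).1; rewrite ltn_eqF.
Qed.

(** Multiples of the socle generator lie in the kernel in degree [i], and for [p <= e - i] also in
    degree [e - i], where the catalecticant matrix has the same rank. *)
Lemma hankel_rank_leq_gt i :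
  (p < e)%N -> has_dim (@socle_piece _ _ I p) 1 -> (p < i <= e)%N ->
  (\rank (hankel e p l1 l2 i) + N (i - p) <= N i)%N /\
  ((p <= e - i)%N ->
   (\rank (hankel e p l1 l2 i) + N (e - i - p) <= N (e - i))%N).
Proof.
move=> pe soc /andP[pi ie]; have [g g0 gl] := socle_generator pe soc.
rewrite hankel_rank_gt // -(catalecticant_sym l1 ie); split=> [|pei].
  by rewrite catalecticant_sym //; apply: catalecticant_rank_multiples gl (ltnW pi).
exact: catalecticant_rank_multiples gl pei.
Qed.

End UpperBounds.

(** * Maximal rank from Cauchy matrices *)

Lemma N0 r : N r 0 = 1%N.
Proof. by rewrite /N bin0. Qed.

Lemma leq_N r i j : (i <= j)%N -> (N r i <= N r j)%N.
Proof.
rewrite /N => /subnKC <-; elim: (j - i)%N => [|m IH]; first by rewrite addn0.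
by apply: leq_trans IH _; rewrite !addnS binS leq_addl.
Qed.

Lemma ltn_N r i j : (1 < r)%N -> (i < j)%N -> (N r i < N r j)%N.
Proof.
move=> r1 ij; apply: leq_trans (leq_N r ij); rewrite /N addnS binS.
by rewrite -[X in (X < _)%N]add0n ltn_add2r bin_gt0; lia.
Qed.

Section Cauchy.

Variables (k : fieldType) (char0 : [pchar k] =i pred0).

Lemma natr_inj : injective (fun m : nat => m%:R : k).
Proof.
move=> a b; wlog ab : a b / (a <= b)%N => [h|].
  by case/orP: (leq_total a b) => /h // h' /esym/h'.
move=> /eqP; rewrite eq_sym -subr_eq0 -natrB // ((pcharf0P _).1 char0) subn_eq0.
by move=> ba; apply/eqP; rewrite eqn_leq ab.
Qed.

Definition cauchy_mx m1 m2 (y : 'I_m1 -> nat) (z : 'I_m2 -> nat) : 'M[k]_(m1, m2) :=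
  \matrix_(a, b) ((y a + z b)%:R)^-1.

(* Clearing denominators, a dependency between the rows becomes a polynomial of
   degree less than [m1] which vanishes at the [m2] points [z b]. *)
Lemma cauchy_free m1 m2 (y : 'I_m1 -> nat) (z : 'I_m2 -> nat) :
  injective y -> injective z -> (forall b, (0 < z b)%N) -> (m1 <= m2)%N ->
  row_free (cauchy_mx y z).
Proof.
move=> y_inj z_inj z0 m12; apply: inj_row_free => c cM.
pose P := \sum_a c 0 a *: \prod_(a' | a' != a) ('X + (y a')%:R%:P : {poly k}).
have P_z b : root P (z b)%:R.
  rewrite /root horner_sum; have -> : \sum_a
      (c 0 a *: \prod_(a' | a' != a) ('X + (y a')%:R%:P : {poly k})).[(z b)%:R] =
      (c *m cauchy_mx y z) 0 b * \prod_a (y a + z b)%:R.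
    rewrite mxE mulr_suml; apply: eq_bigr => a _.
    rewrite hornerZ horner_prod [in RHS](bigD1 a) //= mxE -mulrA; congr (_ * _).
    rewrite mulKf; last first.
      by rewrite ((pcharf0P _).1 char0); have := z0 b; lia.
    by apply: eq_bigr => a' _; rewrite hornerD hornerX hornerC natrD addrC.
  by rewrite cM mxE mul0r.
have P0 : P = 0.
  apply/eqP; apply: contraTT m12 => nz; rewrite -ltnNge.
  have /max_poly_roots := nz.
  move=> /(_ [seq (z b)%:R | b <- enum 'I_m2]); rewrite size_map size_enum_ord => h.
  have {h} m2P : (m2 < size P)%N.
    apply: h; first by apply/allP => _ /mapP[b _ ->].
    rewrite map_inj_uniq ?enum_uniq // => b b' /natr_inj; exact: z_inj.
  apply: leq_trans m2P _; apply: leq_trans (size_sum _ _ _) _.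
  apply/bigmax_leqP => a _; apply: leq_trans (size_scale_leq _ _) _.
  apply: leq_trans (size_poly_prod_leq _ _) _.
  rewrite (eq_bigr (fun => 2%N)) => [|a' _]; last by rewrite size_XaddC.
  rewrite sum_nat_const; have := cardC1 a; rewrite card_ord => ->.
  by case: (m1) (a) => [[]//|m' _] /=; lia.
(* At minus [y a] only the product that omits the factor of index [a] survives, which isolates
   [c 0 a]. *)
apply/rowP => a; rewrite mxE; apply/eqP; have := congr1 (horner^~ (- (y a)%:R)) P0.
rewrite horner0 horner_sum (bigD1 a) //= [X in _ + X]big1 ?addr0.
  move/eqP; rewrite hornerZ horner_prod mulf_eq0 => /orP[//|/prodf_eq0[a' na]].
  rewrite hornerD hornerX hornerC addrC subr_eq0 => /eqP /natr_inj /y_inj aa.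
  by rewrite aa eqxx in na.
move=> a' na; rewrite hornerZ horner_prod (bigD1 a) 1?eq_sym //=.
by rewrite hornerD hornerX hornerC addrC subrr mul0r mulr0.
Qed.

Lemma cauchy_rank m1 m2 (y : 'I_m1 -> nat) (z : 'I_m2 -> nat) :
  injective y -> injective z -> (forall b, (0 < z b)%N) ->
  (forall a, (0 < y a)%N) -> \rank (cauchy_mx y z) = minn m1 m2.
Proof.
move=> y_inj z_inj z0 y0; case: (leqP m1 m2) => m12.
  by apply/eqP/cauchy_free.
have /eqP free_zy := cauchy_free z_inj y_inj y0 (ltnW m12).
rewrite -[RHS]free_zy -mxrank_tr; congr (\rank _); apply/matrixP => a b.
by rewrite !mxE addnC.
Qed.

End Cauchy.

Section MaximalRank.

Variables (k : fieldType) (char0 : [pchar k] =i pred0) (n e p : nat).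
Hypothesis pe : (p <= e)%N.
Local Notation N := (N n.+1).

(* Base-[e.+1] digits: additive, and injective on the monomials of degree at
   most [e]. *)
Definition weight (m : 'X_{1..n.+1}) : nat := (\sum_(j < n.+1) m j * e.+1 ^ j)%N.

Lemma weightD m1 m2 : weight (m1 + m2) = (weight m1 + weight m2)%N.
Proof.
by rewrite -big_split; apply: eq_bigr => j _ /=; rewrite mnmDE mulnDl.
Qed.

Lemma digits_inj B r (c c' : nat -> nat) :
  (forall j, c j < B)%N -> (forall j, c' j < B)%N ->
  (\sum_(j < r) c j * B ^ j = \sum_(j < r) c' j * B ^ j)%N ->
  forall j, (j < r)%N -> c j = c' j.
Proof.
elim: r c c' => // r IH c c' hc hc'.
have E (d : nat -> nat) : (\sum_(j < r.+1) d j * B ^ j =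
    (\sum_(j < r) d j.+1 * B ^ j) * B + d 0)%N.
  rewrite big_ord_recl expn0 muln1 addnC big_distrl; congr (_ + _)%N.
  by apply: eq_bigr => j _; rewrite lift0 expnSr mulnA.
rewrite !E => eq_s.
have e0 : c 0 = c' 0.
  have := congr1 (modn^~ B) eq_s.
  by rewrite !modnMDl !modn_small.
move: eq_s; rewrite e0 => /addIn /eqP; rewrite eqn_pmul2r; last first.
  by have := hc 0; lia.
move=> /eqP eq_s [//|j]; rewrite ltnS => jr.
by apply: (IH (c \o succn) (c' \o succn)) => // i; [apply: hc|apply: hc'].
Qed.

Lemma weight_inj d (i j : 'I_(N d)) :
  (d <= e)%N -> weight (mon i) = weight (mon j) -> i = j.
Proof.
move=> de eq_w; apply/mon_inj/mnmP => t.
have small (u : 'I_(N d)) t' : ((mon u) (inord t') < e.+1)%N.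
  have := mdeg_mon u; rewrite mdegE (bigD1 (inord t')) //= ltnS => du.
  by apply: leq_trans de; rewrite -[X in (_ <= X)%N]du leq_addr.
have := @digits_inj e.+1 n.+1 (fun t => (mon i) (inord t))
  (fun t => (mon j) (inord t)) (small i) (small j).
have E (u : 'I_(N d)) : (\sum_(t < n.+1) (mon u) (inord t) * e.+1 ^ t)%N =
    weight (mon u) by apply: eq_bigr => t' _; rewrite inord_val.
by rewrite !E => /(_ eq_w t (ltn_ord t)); rewrite inord_val.
Qed.

(** Doubling the weight makes the column parameters of the two blocks differ in parity. The offsets
    2 and 3 split as 1 for the row plus 1 or 2 for the column, so all parameters are positive. *)
Definition cauchy_dual (t : nat) (m : 'X_{1..n.+1}) : k := ((2 * weight m + t)%:R)^-1.

Lemma cauchy_hankel_rank i : (i <= e)%N ->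
  \rank (hankel e p (cauchy_dual 2) (cauchy_dual 3) i) =
    minn (N i) (N (e - i) + if (i <= p)%N then N (p - i) else 0).
Proof.
move=> ie; pose y (a : 'I_(N i)) := (2 * weight (mon a) + 1)%N.
have y_inj : injective y by move=> a a'; rewrite /y => ?; apply: (weight_inj ie); lia.
pose z d t (b : 'I_(N d)) := (2 * weight (mon b) + t.+1)%N.
have z_inj d t : (d <= e)%N -> injective (@z d t).
  by move=> de b b'; rewrite /z => ?; apply: (weight_inj de); lia.
have catE d t : (i <= d)%N ->
    catalecticant d (cauchy_dual t.+2) i = cauchy_mx k y (@z (d - i)%N t).
  move=> id; apply/matrixP => a b; rewrite catalecticantE // mxE.
  by rewrite /cauchy_dual weightD /y /z; congr (_%:R)^-1; lia.
case: (leqP i p) => [ip|pi]; last first.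
  rewrite hankel_rank_gt // catE // addn0 cauchy_rank //.
  - by apply: z_inj; lia.
  - by rewrite /z => b; lia.
  by rewrite /y => b; lia.
pose w (b : 'I_(N (e - i) + N (p - i))) : nat :=
  match split b with inl b1 => z (e - i)%N 0 b1 | inr b2 => z (p - i)%N 1 b2 end.
have -> : hankel e p (cauchy_dual 2) (cauchy_dual 3) i = cauchy_mx k y w.
  apply/matrixP => a b; rewrite mxE [RHS]mxE /w.
  by case: splitP => b' _; rewrite catE // mxE.
rewrite cauchy_rank //.
- move=> b b'; rewrite /w; case: (split_ordP b) => b1 ->; case: (split_ordP b') => b2 ->.
  + by move=> h; congr lshift; apply: z_inj h; lia.
  + by rewrite /z; lia.
  + by rewrite /z; lia.
  by move=> h; congr rshift; apply: z_inj h; lia.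
- by move=> b; rewrite /w /z; case: split => ?; lia.
by rewrite /y => b; lia.
Qed.

End MaximalRank.

(** * Functionals supported on a grid *)

Section Grid.

Variables (k : fieldType) (char0 : [pchar k] =i pred0) (n : nat).
Local Notation N := (N n.+2).
Local Notation R := {mpoly k[n.+2]}.
Local Notation x0 := (ord0 : 'I_n.+2).
Local Notation x1 := (lift ord0 ord0 : 'I_n.+2).
Implicit Types b : 'X_{1..n.+2}.

(* [b] encodes the point [(1 : b_1 : ... : b_(n+1))]. *)
Definition grid_point b (j : 'I_n.+2) : k := if j == x0 then 1 else (b j)%:R.

Definition shifted_factor (j : 'I_n.+2) (s : nat) : R := 'X_j - s%:R *: 'X_x0.

Lemma shifted_factor_homog j s : shifted_factor j s \is 1.-homog.
Proof.
by apply: rpredB; [|apply: rpredZ]; rewrite dhomogX; apply/eqP; apply: mdeg1.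
Qed.

Lemma shifted_factor_grid j s b : j != x0 ->
  (shifted_factor j s).@[grid_point b] = (b j)%:R - s%:R.
Proof.
move=> j0; rewrite mevalB mevalZ !mevalXU /grid_point eqxx (negPf j0).
by rewrite mulr1.
Qed.

Lemma homog_bigprod (I : Type) (s : seq I) (P : pred I) (d : I -> nat) (F : I -> R) :
  (forall i, P i -> F i \is (d i).-homog) ->
  \prod_(i <- s | P i) F i \is (\sum_(i <- s | P i) d i)%N.-homog.
Proof.
move=> h; elim/big_rec2: _ => [|i f m Pi hf]; first exact: dhomog1.
by apply: dhomogM => //; apply: h.
Qed.

(** A product of falling factorials in the variables other than [x0], homogenized and padded by
    [x0]. *)
Definition newton_form b : R :=
  'X_x0 ^+ b x0 * \prod_(j | j != x0) \prod_(s < b j) shifted_factor j s.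

Lemma newton_form_homog b : newton_form b \is (mdeg b).-homog.
Proof.
rewrite mdegE (bigD1 x0) //=; apply: dhomogM.
  rewrite -[X in X.-homog]mul1n; apply: dhomogMn.
  by rewrite dhomogX; apply/eqP; apply: mdeg1.
apply: homog_bigprod => j _; rewrite -[X in X.-homog](muln1 (b j)).
rewrite -[X in (X * _)%N](card_ord (b j)) -sum_nat_const.
by apply: homog_bigprod => s _; apply: shifted_factor_homog.
Qed.

Lemma newton_form_grid b a :
  (newton_form b).@[grid_point a] =
    \prod_(j | j != x0) \prod_(s < b j) ((a j)%:R - s%:R).
Proof.
rewrite mevalM rmorphXn /= mevalXU /grid_point eqxx expr1n mul1r rmorph_prod.
apply: eq_bigr => j j0 /=; rewrite rmorph_prod; apply: eq_bigr => s _ /=.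
exact: shifted_factor_grid.
Qed.

Lemma newton_form_grid_neq0 b a :
  ((newton_form b).@[grid_point a] != 0) = [forall (j | j != x0), b j <= a j]%N.
Proof.
rewrite newton_form_grid; apply/idP/forall_inP => [h j j0|h].
  move: h; rewrite prodf_seq_neq0 => /allP/(_ j (mem_index_enum _)).
  rewrite j0 /= leqNgt; apply: contra => lt_ab.
  by rewrite (bigD1 (Ordinal lt_ab)) //= subrr mul0r.
apply/prodf_neq0 => j j0; apply/prodf_neq0 => s _; rewrite subr_eq0.
apply: contraTneq (h j j0) => /(natr_inj char0) ->.
by rewrite -ltnNge.
Qed.

(* The Newton forms are triangular with respect to the grid points. *)
Lemma grid_separation d (w : 'I_(N d) -> k) :
  (forall f, f \is d.-homog -> \sum_u w u * f.@[grid_point (mon u)] = 0) ->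
  forall u, w u = 0.
Proof.
(* Induction on the exponent of [x0]: if the Newton form of [u] is nonzero at another point [v],
   then [v] dominates [u] in the other coordinates, so its exponent of [x0] is smaller. *)
move=> h u; suff: forall t v, (mon v x0 < t)%N -> w v = 0 by apply.
elim=> // t IH {}u ut.
have hom : newton_form (mon u) \is d.-homog.
  by rewrite -[X in X.-homog](mdeg_mon u); apply: newton_form_homog.
have := h _ hom; rewrite (bigD1 u) //= big1 ?addr0 => [/eqP|v vu].
  rewrite mulf_eq0 => /orP[/eqP//|]; rewrite -[_ == 0]negbK newton_form_grid_neq0.
  by case/negP; apply/forall_inP.
have [|] := boolP ((newton_form (mon u)).@[grid_point (mon v)] == 0).
  by move=> /eqP ->; rewrite mulr0.
rewrite newton_form_grid_neq0 => /forall_inP le_uv.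
rewrite IH ?mul0r //; apply: leq_trans (ut : _ <= t)%N; rewrite ltnNge.
apply: contra vu => le0; apply/eqP/mon_inj.
have le_m : (mon u <= mon v)%MM.
  by apply/mnm_lepP => j; have [->//|/le_uv] := eqVneq j x0.
have := congr1 (@mdeg _) (submK le_m); rewrite mdegD !mdeg_mon.
move=> /eqP; rewrite -[X in _ == X]add0n eqn_add2r mdeg_eq0 => /eqP vu0.
by rewrite -(submK le_m) vu0 add0m.
Qed.

Definition evaluation_dual (J : finType) (C : pred J) (v : J -> 'I_n.+2 -> k) b : k :=
  \sum_(t | C t) ('X_[b] : R).@[v t].

Lemma apolar_evaluation (J : finType) (C : pred J) (v : J -> 'I_n.+2 -> k) d f :
  f \is d.-homog ->
  apolar d (evaluation_dual C v) f = \sum_(t | C t) f.@[v t].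
Proof.
move=> /homog_form ->; set c := \row__ _; rewrite /apolar.
under eq_bigr => i _ do rewrite mcoeff_form /evaluation_dual mulr_sumr.
rewrite exchange_big; apply: eq_bigr => t _ /=; rewrite rmorph_sum /=.
by apply: eq_bigr => i _; rewrite mevalZ.
Qed.

Section HypersurfaceDual.

Variables (e p : nat).
Hypotheses (p0 : (0 < p)%N) (pe : (2 * p <= e)%N).
Local Notation m := (e./2).

Definition in_strip b := (b x1 < p)%N.

(** Monomials of degree [m] encode the points with coordinate sum at most [m], the exponent of [x0]
    being the slack. *)
Definition strip_dual : 'X_{1..n.+2} -> k :=
  evaluation_dual (fun u : 'I_(N m) => in_strip (mon u)) (fun u => grid_point (mon u)).

(** Pairing [form c] with all forms of degree [m], padded by [x0], gives vanishing sums weighted by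
    the values of [form c]; separation makes these values zero. Padding [mon u] by [x0] does not
    move its point. *)
Lemma strip_dual_ker i (c : 'rV_(N i)) (u : 'I_(N i)) : (i <= m)%N ->
  c *m catalecticant e strip_dual i = 0 -> in_strip (mon u) ->
  (form c).@[grid_point (mon u)] = 0.
Proof.
move=> im /catalecticant_ker cE us.
pose w (v : 'I_(N m)) := if in_strip (mon v) then (form c).@[grid_point (mon v)] else 0.
have w0 : forall v, w v = 0.
  apply: grid_separation => f hf; have := cE (f * 'X_x0 ^+ (e - m - i)).
  rewrite apolar_evaluation; last first.
    rewrite -[X in X.-homog](_ : i + (m + (1 * (e - m - i))) = e)%N; last by lia.
    apply: dhomogM; first exact: form_homog.
    apply: dhomogM => //.
    by apply: dhomogMn; rewrite dhomogX; apply/eqP; apply: mdeg1.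
  rewrite big_mkcond => sum0; rewrite -[RHS]sum0; apply: eq_bigr => v _; rewrite /w.
  case: ifP => _; last by rewrite mul0r.
  by rewrite !mevalM rmorphXn /= mevalXU /grid_point eqxx expr1n mulr1.
pose b := (mon u + U_(x0) *+ (m - i))%MM.
have [v bE] : exists v : 'I_(N m), b = mon v.
  by apply: mon_surj; rewrite mdegD mdeg_mon mdegMn mdeg1; lia.
have bj j : j != x0 -> b j = mon u j.
  by move=> j0; rewrite mnmDE mulmnE mnm1E eq_sym (negPf j0) mul0n addn0.
have := w0 v; rewrite /w -bE /in_strip bj // -/(in_strip _) us => <-.
by apply: meval_eq => j; rewrite /grid_point; case: ifP => // /negbT /bj ->.
Qed.

(** A monomial outside the strip is divisible by the [p]-th power of [x1], with quotient of degree
    [i - p]. *)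
Lemma card_strip i :
  (N i <= #|[pred u : 'I_(N i) | in_strip (mon u)]| +
     if p <= i then N (i - p) else 0)%N.
Proof.
rewrite -[X in (X <= _)%N]card_ord.
rewrite -(cardC [pred u : 'I_(N i) | in_strip (mon u)]) leq_add2l.
case: (leqP p i) => pi; last first.
  rewrite leqn0; apply/eqP/eq_card0 => u; apply/negbTE; rewrite !inE negbK /in_strip.
  apply: leq_ltn_trans pi; have := mdeg_mon u.
  by rewrite mdegE (bigD1 x1) //= => iE; rewrite -[X in (_ <= X)%N]iE leq_addr.
have /fin_all_exists [F hF] (v : 'I_(N (i - p))) :
    exists u : 'I_(N i), (mon v + U_(x1) *+ p)%MM = mon u.
  by apply: mon_surj; rewrite mdegD mdeg_mon mdegMn mdeg1; lia.
rewrite -[X in (_ <= X)%N]card_ord; apply: leq_trans (leq_image_card F _).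
apply/subset_leq_card/subsetP => u; rewrite !inE /in_strip -leqNgt => pu.
have le_m : (U_(x1) *+ p <= mon u)%MM.
  apply/mnm_lepP => j; rewrite mulmnE mnm1E.
  by case: eqP => [<-|_]; rewrite ?mul1n ?mul0n.
have [v vE] : exists v : 'I_(N (i - p)), (mon u - U_(x1) *+ p)%MM = mon v.
  apply: mon_surj; have := congr1 (@mdeg _) (submK le_m).
  by rewrite mdegD mdeg_mon mdegMn mdeg1; lia.
by apply/imageP; exists v => //; apply: mon_inj; rewrite -hF -vE submK.
Qed.

(** The kernel consists of forms vanishing at the strip points of degree [i]. These impose
    independent conditions, so the rank is at least their number. *)
Lemma strip_dual_rank i : (i <= m)%N ->
  (N i <= \rank (catalecticant e strip_dual i) + if p <= i then N (i - p) else 0)%N.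
Proof.
move=> im; apply: leq_trans (card_strip i) _; rewrite leq_add2r.
set S := [pred u | _].
pose E := \matrix_(b < #|S|, a < N i) ('X_[mon a] : R).@[grid_point (mon (enum_val b))].
have mulE (c : 'rV_(N i)) (b : 'I_#|S|) :
    (c *m E^T) 0 b = (form c).@[grid_point (mon (enum_val b))].
  rewrite mxE rmorph_sum /=; apply: eq_bigr => a _.
  by rewrite mevalZ !mxE.
have freeE : row_free E.
  apply: inj_row_free => c cE.
  pose w u := \sum_(b | enum_val b == u) c 0 b.
  have w0 u : w u = 0.
    apply: grid_separation u => f /homog_form ->; set d := \row__ _.
    have := congr1 (fun M => (M *m d^T) 0 0) cE; rewrite mul0mx -mulmxA !mxE.
    move=> sum0; rewrite -[RHS]sum0.
    rewrite [RHS](partition_big (@enum_val _ S) predT) //=; apply: eq_bigr => u _.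
    rewrite mulr_suml; apply: eq_bigr => b /eqP <-.
    by rewrite -[E]trmxK -trmx_mul mxE mulE.
  apply/rowP => b; rewrite mxE -(w0 (enum_val b)) /w (eq_bigl (pred1 b)) ?big_pred1_eq //.
  by move=> b'; rewrite (inj_eq enum_val_inj).
have /eqP rkE := freeE; rewrite -[X in (X <= _)%N]rkE -mxrank_tr.
have : (kermx (catalecticant e strip_dual i) <= kermx E^T)%MS.
  apply/row_subP => a; apply/sub_kermxP/rowP => b; rewrite mulE mxE.
  apply: strip_dual_ker => //; last exact: (enum_valP b).
  by apply/sub_kermxP/row_sub.
move=> /mxrankS; rewrite !mxrank_ker.
by rewrite leq_sub2lE ?rank_leq_row.
Qed.

Definition strip_form : R := \prod_(s < p) shifted_factor x1 s.

Lemma strip_form_homog : strip_form \is p.-homog.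
Proof.
rewrite -[X in X.-homog](muln1 p) -[X in (X * _)%N](card_ord p) -sum_nat_const.
by apply: homog_bigprod => s _; apply: shifted_factor_homog.
Qed.

Lemma strip_form_vanishes q : apolar e strip_dual (strip_form * q) = 0.
Proof.
move: q; apply: apolar_monomials => b _.
have hom : strip_form * 'X_[b] \is (p + mdeg b).-homog.
  by apply: dhomogM; [exact: strip_form_homog|rewrite dhomogX].
have [de|ne] := eqVneq (p + mdeg b)%N e; last exact: apolar_homog hom ne.
rewrite apolar_evaluation; last by rewrite -[X in X.-homog]de.
rewrite big1 // => u us; rewrite mevalM rmorph_prod (bigD1 (Ordinal us)) //=.
by rewrite shifted_factor_grid // subrr !mul0r.
Qed.

(** Evaluation at (0 : 1 : 0 : ... : 0), where each factor of [strip_form] equals 1. *)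
Definition x1_dual : 'X_{1..n.+2} -> k :=
  evaluation_dual (fun _ : 'I_1 => true) (fun _ j => (j == x1)%:R).

Lemma x1_dual_strip_form : apolar p x1_dual strip_form = 1.
Proof.
rewrite apolar_evaluation ?strip_form_homog // big_ord1 rmorph_prod big1 // => s _ /=.
by rewrite mevalB mevalZ !mevalXU eqxx mulr0 subr0.
Qed.

Lemma strip_generator : exists c : 'rV_(N p),
  c *m catalecticant e strip_dual p = 0 /\ c *m catalecticant p x1_dual p != 0.
Proof.
exists (\row_(u < N p) strip_form@_(mon u)); split.
  apply/catalecticant_ker => q; rewrite -(homog_form strip_form_homog).
  exact: strip_form_vanishes.
apply: contra_neqN (oner_neq0 k) => /eqP/catalecticant_ker/(_ 1).
by rewrite -(homog_form strip_form_homog) mulr1 x1_dual_strip_form.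
Qed.

Lemma strip_hankel_free i : (i <= p)%N ->
  row_free (hankel e p strip_dual x1_dual i).
Proof.
move=> ip; have im : (i <= m)%N by lia.
apply: inj_row_free => c; rewrite mul_mx_row -[X in _ = X]row_mx0 => /eq_row_mx[c1 c2].
have := strip_dual_rank im; case: (leqP p i) => pi; last first.
  by rewrite addn0 row_leq_rank => /row_free_inj; apply; rewrite c1 mul0mx.
have ei : i = p by apply/eqP; rewrite eqn_leq ip.
subst i; rewrite subnn N0 => rk; apply/eqP; apply/negPn/negP => c0.
have [g [g1 /eqP]] := strip_generator; apply.
(* The kernel of the first block has dimension at most 1, so the nonzero [c] spans it. Then [g] is a
   multiple of [c] and is killed by the second functional too, a contradiction. *)
have : (c <= kermx (catalecticant e strip_dual p))%MS by apply/sub_kermxP.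
move=> /mxrank_leqif_sup/geq_leqif; rewrite rank_rV c0 mxrank_ker leq_subLR rk.
move=> /esym/(submx_trans _)-/(_ _ g); rewrite sub_kermx g1 eqxx => /(_ isT).
by case/submxP=> d ->; rewrite -mulmxA c2 mulmx0.
Qed.

End HypersurfaceDual.
End Grid.

(** * Generalized compressed algebras *)

(** The first case includes [p = e], two socle generators in the top degree. The last subtracts the
    multiples of the socle generator in the smaller of the degrees [i] and [e - i]. *)
Definition max_h r e p i : nat :=
  if (e < 2 * p)%N then
    minn (N r i) (N r (e - i) + if (i <= p)%N then N r (p - i) else 0)
  else if (i <= p)%N then N r i
  else let j := minn i (e - i) in
    (N r j - if (p <= j)%N then N r (j - p) else 0)%N.

Section Compressed.

Variables (k : fieldType) (n e p : nat) (s : nat -> nat).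
Hypothesis pe : (p <= e)%N.
Hypothesis sE : forall j, (j <= e)%N -> s j = ((j == e) + (j == p))%N.
Local Notation N := (N n.+2).

Lemma h_vector_leq (A : art_algebra k n.+2 e) (h : nat -> nat) :
  (forall j, (j <= e)%N -> has_dim (@socle_piece _ _ A j) (s j)) ->
  (forall j, (j <= e)%N -> has_dim (@graded_piece _ _ A j) (h j)) ->
  forall i, (i <= e)%N -> (h i <= max_h n.+2 e p i)%N.
Proof.
move=> soc hA i ie.
have [l1 [l2 dualA]] := macaulay_dual pe soc sE (hA p pe).
rewrite (has_dim_uniq (hA i ie) (graded_piece_dim dualA i)).
have := hankel_rank_leq e p l1 l2 i; rewrite /max_h; case: (ltnP e) => [//|ep].
rewrite leq_min => /andP[le1 le2]; case: (leqP i p) => [//|pi].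
have lt_pe : (p < e)%N by apply: leq_trans ie.
have soc_p : has_dim (@socle_piece _ _ A p) 1.
  by move: (soc p pe); rewrite sE // eqxx ltn_eqF.
have [|b1 b2] := hankel_rank_leq_gt dualA lt_pe soc_p (i := i).
  by rewrite pi.
have {}le2 : (\rank (hankel e p l1 l2 i) <= N (e - i))%N.
  by move: le2; rewrite [(i <= p)%N]leqNgt pi addn0.
rewrite /minn; case: (ltnP i (e - i)) => _ /=; first by rewrite (ltnW pi); lia.
by case: (leqP p) => [/b2|_]; lia.
Qed.

Hypotheses (p0 : (0 < p)%N) (e1 : (1 < e)%N).
Hypothesis char0 : [pchar k] =i pred0.

(** Lower bounds on the ranks suffice: the upper bounds apply to the constructed algebra itself and
    force equality. *)
Lemma exists_from_dual l1 l2 :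
  \rank (hankel e p l1 l2 1) = N 1 ->
  \rank (hankel e p l1 l2 e) = (1 + (p == e))%N ->
  ((p < e)%N -> exists c : 'rV[k]_(N p),
     c *m catalecticant e l1 p = 0 /\ c *m catalecticant p l2 p != 0) ->
  (forall i, (i <= e)%N -> (max_h n.+2 e p i <= \rank (hankel e p l1 l2 i))%N) ->
  exists A : art_algebra k n.+2 e,
    (forall j, (j <= e)%N -> has_dim (@socle_piece _ _ A j) (s j)) /\
    (forall j, (j <= e)%N -> has_dim (@graded_piece _ _ A j) (max_h n.+2 e p j)).
Proof.
move=> /eqP free1 rk_e ex_c ge_h.
have top : hankel e p l1 l2 e != 0 by rewrite -mxrank_eq0 rk_e.
have [A dualA] := exists_dual_algebra pe free1 top.
have soc := socle_piece_dim dualA pe rk_e ex_c sE.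
exists A; split=> // j je; have := graded_piece_dim dualA j.
suff -> : \rank (hankel e p l1 l2 j) = max_h n.+2 e p j by [].
apply/eqP; rewrite eqn_leq ge_h // andbT.
apply: (h_vector_leq soc (h := fun j => \rank (hankel e p l1 l2 j))) => // i ie.
exact: graded_piece_dim.
Qed.

Lemma exists_compressed : exists A : art_algebra k n.+2 e,
    (forall j, (j <= e)%N -> has_dim (@socle_piece _ _ A j) (s j)) /\
    (forall j, (j <= e)%N -> has_dim (@graded_piece _ _ A j) (max_h n.+2 e p j)).
Proof.
have [ep|ep] := ltnP e (2 * p).
  pose l1 : 'X_{1..n.+2} -> k := cauchy_dual k e 2.
  pose l2 : 'X_{1..n.+2} -> k := cauchy_dual k e 3.
  have rkE i (ie : (i <= e)%N) := cauchy_hankel_rank char0 n.+1 pe ie.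
  apply: (exists_from_dual (l1 := l1) (l2 := l2)).
  - rewrite rkE ?(ltnW e1) // p0; apply/minn_idPl.
    by apply: leq_trans (leq_addr _ _); apply: leq_N; lia.
  - rewrite rkE // subnn N0; have := @ltn_N n.+2 0 e isT (ltnW e1); rewrite N0 => N1.
    have -> : (if (e <= p)%N then N (p - e) else 0%N) = (p == e).
      rewrite eqn_leq pe /=; case: (leqP e p) => // ep'.
      by rewrite (_ : p - e = 0)%N ?N0 //; lia.
    by apply/minn_idPr; case: (p == e); lia.
  - move=> lt_pe.
    (* As [e - p < p], there are at most as many columns as rows, so the columns are independent and
       the pair of values [0] and [b] is attained, which gives the socle generator. *)
    have : row_full (hankel e p l1 l2 p).
      apply/eqP; rewrite rkE // leqnn; apply/minn_idPr.
      by rewrite subnn N0 addn1; apply: ltn_N => //; lia.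
    have [b b0] : exists b : 'rV[k]_(N (p - p)), b != 0.
      exists (const_mx 1); rewrite subnn; apply/eqP => /matrixP/(_ ord0).
      have i0 : 'I_(N 0) by rewrite N0; exact: ord0.
      by move=> /(_ i0); rewrite !mxE; apply/eqP/oner_neq0.
    move=> /(submx_full (row_mx 0 b))/submxP[c]; rewrite mul_mx_row.
    by move=> /eq_row_mx[c1 c2]; exists c; rewrite -c1 -c2.
  by move=> i ie; rewrite rkE // /max_h ep.
have lt_pe : (p < e)%N by lia.
pose l1 : 'X_{1..n.+2} -> k := strip_dual k e p.
pose l2 : 'X_{1..n.+2} -> k := @x1_dual k n.
have sym i : (i <= e)%N -> (p < i)%N ->
    \rank (hankel e p l1 l2 i) = \rank (catalecticant e l1 (e - i)).
  by move=> ie pi; rewrite hankel_rank_gt // catalecticant_sym.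
apply: (exists_from_dual (l1 := l1) (l2 := l2)).
- exact/eqP/strip_hankel_free.
- rewrite sym // subnn (ltn_eqF lt_pe) addn0; apply/eqP; rewrite eqn_leq.
  rewrite -[X in (_ <= X)%N && _](N0 n.+2) rank_leq_row /=.
  have := @strip_dual_rank k char0 n e p p0 ep 0 (leq0n _).
  by rewrite (leqNgt p 0) p0 addn0; apply: leq_trans; rewrite N0.
- by move=> _; apply: strip_generator.
move=> i ie; rewrite /max_h ltnNge ep /=; case: (leqP i p) => pi.
  by have /eqP -> := strip_hankel_free char0 n p0 ep pi.
rewrite leq_subLR addnC /minn; case: (ltnP i (e - i)) => ii.
  by rewrite hankel_rank_gt //; apply: strip_dual_rank => //; lia.
by rewrite sym //; apply: strip_dual_rank => //; lia.
Qed.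

End Compressed.

(* Numerical identities and conclusion *)
Local Close Scope quotient_scope.
Local Close Scope ring_scope.

Lemma type2_socle_vector e (s : e.+1.-tuple nat) :
  1 < e -> nth 0 s 0 = 0 -> 0 < nth 0 s e -> socle_type s = 2 ->
  exists p, 0 < p <= e /\ forall j, j <= e -> nth 0 s j = (j == e) + (j == p).
Proof.
move=> e1 s0 se; rewrite /socle_type big_nat_recr /=; last by lia.
set S := \sum_(_ <= _ < _) _ => sum2; have [S0|S1] : S = 0 \/ S = 1 by lia.
  exists e; split=> [|j je]; first by rewrite leqnn (ltnW e1).
  have [->|ne] := eqVneq j e; first by lia.
  have [->//|j0] := posnP j.
  move/eqP: S0; rewrite sum_nat_seq_eq0 => /allP/(_ j).
  by rewrite mem_index_iota j0 ltn_neqAle ne je => /(_ isT)/eqP.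
have [p [pS _ sp others]] := sum_nat_seq_eq1 S1.
move: pS; rewrite mem_index_iota => /andP[p0 lt_pe].
exists p; split=> [|j je]; first by rewrite p0 ltnW.
have [->|ne] := eqVneq j e; first by rewrite gtn_eqF //; lia.
have [->//|np] := eqVneq j p.
have [->//|j0] := posnP j.
by apply: others => //; rewrite mem_index_iota j0 ltn_neqAle ne.
Qed.

Lemma sum_delta (F : nat -> nat) d i m :
  \sum_(i <= j < m) F j * (j == d) = if i <= d < m then F d else 0.
Proof.
rewrite -[RHS](big_nat1_eq addn) [RHS]big_mkcond; apply: eq_bigr => j _.
by case: eqP => _; rewrite ?muln1 ?muln0.
Qed.

Lemma N_sub_r r e (s : e.+1.-tuple nat) p i :
  (forall j, j <= e -> nth 0 s j = (j == e) + (j == p)) -> i <= e -> p <= e ->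
  (Posz (N r i) - r_ r s i)%R =
  Posz (N r (e - i) + if i <= p then N r (p - i) else 0).
Proof.
move=> sE ie pe; rewrite /r_ opprB addrCA subrr addr0.
rewrite -(big_morph Posz PoszD (erefl _)); congr Posz.
rewrite (eq_big_nat _ _ (F2 := fun j => N r (j - i) * (j == e) + N r (j - i) * (j == p))).
  by rewrite big_split /= !sum_delta !ltnS ie leqnn pe !andbT.
by move=> j /andP[_ je]; rewrite sE // mulnDr.
Qed.

(** At the boundary [e = 2 * p] the two formulas agree: for [i > p] one has [e - i < p], so nothing
    is subtracted. *)
Lemma max_h_large_p r e p i : i <= e -> e <= 2 * p ->
  max_h r e p i =
  minn (N r i) (N r (e - i) + if i <= p then N r (p - i) else 0).
Proof.
rewrite /max_h => ie; case: (ltnP e (2 * p)) => // pe1 pe2.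
have eE : e = 2 * p by apply/eqP; rewrite eqn_leq pe1 pe2.
case: (leqP i p) => ip.
  symmetry; apply/minn_idPl; apply: leq_trans (leq_addr _ _).
  by apply: leq_N; lia.
have /minn_idPr -> : e - i <= i by lia.
rewrite leqNgt (_ : e - i < p) /=; last by lia.
by rewrite subn0 addn0; symmetry; apply/minn_idPr/leq_N; lia.
Qed.

(** By the hockey-stick identity [N n.+2 p] is the sum of ['C(n + l, l)] for [l] from 0 to [p]; the
    term [l = 0] is the 1 removed. *)
Lemma binomial_expansion_pred n p : 0 < p ->
  binomial_expansion (N n.+2 p - 1) p 1 (fun l => n + l).
Proof.
move=> p0; split=> //; first by rewrite addn1.
  by move=> l _; rewrite addnS.
suff -> : N n.+2 p = (\sum_(1 <= l < p.+1) 'C(n + l, l)).+1 by rewrite subn1.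
rewrite /N subSS subn0; elim: p {p0} => [|p IH]; first by rewrite bin0 big_nil.
by rewrite big_nat_recr //= -[RHS]addSn -IH !addnS !addSn binS addnC.
Qed.

Lemma sum_shifted_expansion n p a :
  \sum_(1 <= l < p.+1) 'C(n + l + a, l + a) = N n.+2 (p + a) - N n.+2 a.
Proof.
suff E : \sum_(1 <= l < p.+1) 'C(n + l + a, l + a) + N n.+2 a = N n.+2 (p + a).
  by rewrite -E addnK.
elim: p => [|p IH]; first by rewrite big_nil.
rewrite big_nat_recr //= addnAC IH /N !subSS !subn0 !addSn !addnS binS addnC.
by rewrite addnA.
Qed.

Theorem corollary3p2 (k : fieldType) (char0 : [pchar k]%R =i pred0)
    (r e : nat) (s : e.+1.-tuple nat) (r0 : nat) :
  1 < r -> 1 < e ->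
  nth 0 s 0 = 0 -> 0 < nth 0 s e ->
  is_min_emb_dim k s r0 -> r0 <= r ->
  socle_type s = 2 ->
  (exists A : art_algebra k r e, generalized_compressed s A) /\
  (forall p : nat, 1 <= p < e -> nth 0 s e = 1 -> nth 0 s p = 1 ->
   forall (A : art_algebra k r e) (h : e.+1.-tuple nat),
   generalized_compressed s A -> is_h_vector A h ->
   (e <= 2 * p ->
      forall i, i <= e ->
        Posz (nth 0 h i) =
          Num.min (Posz (N r i) - r_ r s i)%R (Posz (N r i))) /\
   (2 * p < e ->
      [/\ forall i, i <= p -> nth 0 h i = N r i,
          forall a, 1 <= a <= e./2 - p ->
            is_shifted_expansion (N r p - 1) p a (nth 0 h (p + a)),
          forall i, e./2 < i <= e -> i != e - p ->
            nth 0 h i = nth 0 h (e - i)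
        & nth 0 h (e - p) = N r p - 1])).
Proof.
case: r => [|[|n]] // _ e1 s0 se _ _ type2.
have [q [/andP[q0 qe] sE]] := type2_socle_vector e1 s0 se type2.
have [A0 [soc0 hA0]] := exists_compressed n qe sE q0 e1 char0.
pose H := [tuple of mkseq (max_h n.+2 e q) e.+1].
have HE i : i <= e -> nth 0 H i = max_h n.+2 e q i.
  by move=> ie; rewrite nth_mkseq.
have adm : admissible k n.+2 s H.
  by exists A0; split=> // i ie; rewrite HE //; apply: hA0.
have bound h : admissible k n.+2 s h ->
    forall i, i <= e -> nth 0 h i <= max_h n.+2 e q i.
  move=> [A [soc hA]]; exact: (h_vector_leq qe sE soc (h := nth 0 h) hA).
split.
  exists A0; split=> //; exists H; last by move=> i ie; rewrite HE //; apply: hA0.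
  by split=> // h /bound hb i ie; rewrite HE //; apply: hb.
move=> p /andP[p0 lt_pe] _ sp A h [_ [h' [adm' max'] hA']] hA.
have qp : q = p.
  by move: (sE p (ltnW lt_pe)); rewrite sp (ltn_eqF lt_pe); case: eqP.
subst q.
have hE i : i <= e -> nth 0 h i = max_h n.+2 e p i.
  move=> ie; rewrite (has_dim_uniq (hA i ie) (hA' i ie)); apply/eqP.
  by rewrite eqn_leq bound // -HE // max'.
split=> [e2p i ie|p2e].
  rewrite hE // max_h_large_p // (N_sub_r _ sE) // minnC.
  by rewrite /minn /Order.min ltz_nat; case: ifP.
have hE' i : i <= e -> nth 0 h i = if i <= p then N n.+2 i else
    let j := minn i (e - i) in N n.+2 j - if p <= j then N n.+2 (j - p) else 0.
  by move=> ie; rewrite hE // /max_h ltnNge (ltnW p2e).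
split.
- by move=> i ip; rewrite hE' ?ip //; lia.
- move=> a /andP[a0 ap]; exists 1, (fun l => n + l); split.
    exact: binomial_expansion_pred.
  rewrite sum_shifted_expansion hE'; last by lia.
  have /minn_idPl -> : p + a <= e - (p + a) by lia.
  have -> : p + a <= p = false by lia.
  by rewrite /= leq_addr addKn.
- move=> i /andP[ie2 ie] ne; rewrite !hE' ?leq_subr // subKn // minnC.
  have /minn_idPl -> : e - i <= i by lia.
  have -> : i <= p = false by lia.
  (* For [e - i > p] both entries have the same formula. Otherwise [e - i < p], as equality is
     excluded, and nothing is subtracted. *)
  case: (leqP (e - i) p) => //= eip.
  by rewrite (_ : p <= e - i = false) ?subn0 //; lia.
rewrite hE' ?leq_subr // subKn ?(ltnW lt_pe) //.
have -> : e - p <= p = false by lia.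
have /minn_idPr -> : p <= e - p by lia.
by rewrite /= leqnn subnn N0.
Qed.
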